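(* Let the finite groups $G$ and $H$ belong to the collection $CSE$. Then: (1) $G\times H$ belongs to $CSE$. (2) $\mu(G\times H)=\mu(G)+\mu(H)$.
   Context: For a finite group $G$, $\mu(G)$ denotes the least positive integer $n$ such that $G$ embeds in the symmetric group $S_n$. The socle $\mathrm{Soc}(G)$ of a finite group $G$ is the subgroup generated by all minimal (nontrivial) normal subgroups of $G$, and $Z(G)$ is the center of $G$. $CS$ is the collection of all nontrivial finite groups $G$ with $\mathrm{Soc}(G)\leq Z(G)$. $CSE$ is the collection of all finite groups $G$ for which there is a subgroup $G_0\leq G$ such that $G_0\in CS$ and $\mu(G_0)=\mu(G)$. *)

(* Defs.v *)
From HB Require Import structures.
From mathcomp Require Import all_boot all_fingroup all_solvable.

Set Implicit Arguments.
Unset Strict Implicit.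
Unset Printing Implicit Defensive.

Local Open Scope group_scope.

Definition embeds_in_Sym (gT : finGroupType) (G : {group gT}) (n : nat) : bool :=
  [exists K : {group 'S_n}, G \isog K].

(* Cayley's theorem, through the regular action of gT on its own
   enumeration. *)
Lemma embeds_in_Sym_ex (gT : finGroupType) (G : {group gT}) :
  exists n, (0 < n)%N && embeds_in_Sym G n.
Proof.
exists #|gT|; apply/andP; split; first by apply/card_gt0P; exists 1.
pose p (x : gT) (i : 'I_#|gT|) := enum_rank (enum_val i * x).
have p_inj x : injective (p x).
  by move=> i j /enum_rank_inj/mulIg/enum_val_inj.
have pM : {in G &, {morph (fun x => perm (@p_inj x)) : x y / x * y}}.
  move=> x y _ _; apply/permP=> i.
  by rewrite permM !permE /p enum_rankK mulgA.
pose f := Morphism pM.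
have f_inj : 'injm f.
  apply/injmP=> x y _ _ /permP/(_ (enum_rank 1)).
  by rewrite !permE /p enum_rankK !mul1g => /enum_rank_inj.
by apply/existsP; exists (f @* G)%G; apply: (sub_isog (subxx G) f_inj).
Qed.

(* Least positive degree: the trivial group gets mu = 1, not 0. *)
Definition mu (gT : finGroupType) (G : {group gT}) : nat :=
  ex_minn (embeds_in_Sym_ex G).

(* minnormal N G does not by itself require N to lie inside G. *)
Definition Soc (gT : finGroupType) (G : {group gT}) : {set gT} :=
  <<\bigcup_(N : {group gT} | (N \subset G) && minnormal N G) N>>.

Definition CS (gT : finGroupType) (G : {group gT}) : Prop :=
  G :!=: 1 /\ Soc G \subset 'Z(G).

Definition CSE (gT : finGroupType) (G : {group gT}) : Prop :=
  exists G0 : {group gT}, [/\ G0 \subset G, CS G0 & mu G0 = mu G].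

(* Main.v *)
Require Import Defs.
From HB Require Import structures.
From mathcomp Require Import all_boot all_fingroup all_solvable.

(** Faithful permutation representations of degree n correspond to families of
    subgroups with indices adding up to n whose intersection contains no
    nontrivial normal subgroup (point stabilisers one way, coset actions the
    other). When the socle of G is central, every nontrivial normal subgroup
    meets Z(G), and subgroups of Z(G) are normal in G; so a family is faithful
    exactly when its intersection with Z(G) is trivial. This turns faithfulness
    into a question about the finite abelian group Z(G).

    Let now G = A \x B with A and B of this kind, and take a family realising
    mu G. Two steps produce faithful families for A and for B whose index sums
    add up to at most mu G.

    Refinement ([refine_subgroup]). Suppose the trace of a member H on Z = Z(G)
    is the intersection of two strictly larger subgroups K1, K2 of Z. As they
    are central, H K1 and H K2 are subgroups, each of index at most half that
    of H, and their traces on Z are K1 and K2. So H may be replaced by the pair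
    without increasing the index sum. Eventually every trace is
    meet-irreducible among the subgroups of Z.

    Splitting ([split_family]). The members can then be distributed between
    Z(A) and Z(B) so that each part intersects its own factor trivially. If the
    traces were hyperplanes of a vector space, this would be the choice of two
    complementary nonzero minors in the Laplace expansion of a nonzero
    determinant; here the members are distributed one at a time, and
    irreducibility guarantees that one of the two choices is always good.

    Intersecting the first part with A and the second with B cannot increase
    indices, so mu A + mu B <= mu (A \x B) ([mu_dprod_ge]). The reverse
    inequality holds for all groups, and centrality of the socle passes to
    direct products ([center_detects_dprod]). For G and H in the larger class
    one sandwiches mu (G x H) between mu (G0 x H0) = mu G0 + mu H0 and
    mu G + mu H. *)

Set Implicit Arguments.
Unset Strict Implicit.
Unset Printing Implicit Defensive.

Local Open Scope group_scope.

(** * Permutation representations and their kernels *)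

Section PermRep.

Variable gT : finGroupType.
Implicit Types (G H K : {group gT}) (Hs : seq {group gT}).

(** Recording the kernel, and not only faithful representations, lets a faithful
    one be assembled from its orbits. The points form an arbitrary finite type,
    so that disjoint unions and coset spaces need no renumbering. *)
Definition perm_rep G (N : {set gT}) n :=
  exists (T : finType) (f : {morphism G >-> {perm T}}), #|T| = n /\ 'ker f = N.

Lemma perm_rep_trivial G n : perm_rep G G n.
Proof.
pose f : gT -> {perm 'I_n} := fun=> 1.
have fM : {in G &, {morph f : x y / x * y}} by move=> x y _ _; rewrite mulg1.
exists 'I_n, (Morphism fM); rewrite card_ord; split=> //.
by apply/setP=> x; rewrite !inE /= eqxx andbT.
Qed.

Lemma perm_rep_cosets G H : H \subset G -> perm_rep G (gcore H G) #|G : H|.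
Proof.
move=> sHG; pose P := [pred A : {set gT} | A \in rcosets H G].
pose sT := {A : {set gT} | P A}.
have PE : [set A | P A] = rcosets H G by apply/setP=> A; rewrite inE.
pose to := subaction sT 'Rs.
have sGto : G \subset subact_dom P 'Rs.
  by rewrite /subact_dom PE; apply: actsRs_rcosets.
exists sT, (actperm (to \ sGto)); split.
  by rewrite card_sub /=; apply: eq_card.
rewrite ker_actperm astab_ract astab_subact.
have -> : val @: [set: sT] = rcosets H G.
  rewrite -PE; apply/setP=> A; rewrite !inE; apply/imsetP/idP.
    by case=> u _ ->; apply: valP.
  by move=> PA; exists (Sub A PA); rewrite ?inE ?SubK.
rewrite /subact_dom PE astabRs_rcosets setIA.
apply/setIidPr/subsetP=> x xK.
have xG : x \in G by apply: (subsetP sHG); apply: (subsetP (gcore_sub H G)).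
by have := subsetP sGto x xG; rewrite /subact_dom PE in_setI xG.
Qed.

(** The representation is the disjoint union of the two given ones. *)
Lemma perm_rep_sum G (N1 N2 : {set gT}) n1 n2 :
  perm_rep G N1 n1 -> perm_rep G N2 n2 -> perm_rep G (N1 :&: N2) (n1 + n2).
Proof.
case=> T1 [f1 [<- <-]] [T2 [f2 [<- <-]]].
pose F x (u : T1 + T2) : T1 + T2 :=
  match u with inl a => inl (f1 x a) | inr b => inr (f2 x b) end.
have F_inj x : injective (F x).
  by move=> [a|b] [c|d] //= [] /perm_inj ->.
have FM : {in G &, {morph (fun x => perm (@F_inj x)) : x y / x * y}}.
  move=> x y Gx Gy; apply/permP=> u; rewrite permM !permE.
  by case: u => u /=; rewrite morphM // permM.
exists (T1 + T2)%type, (Morphism FM); split; first by rewrite card_sum.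
apply/setP=> x; rewrite !inE; case Gx: (x \in G) => //=.
apply/eqP/andP=> [/permP fx1 | [/eqP f1x1 /eqP f2x1]]; last first.
  by apply/permP=> -[a|b]; rewrite !permE /= ?f1x1 ?f2x1 perm1.
split; apply/eqP/permP=> a; rewrite perm1.
  by have := fx1 (inl a); rewrite !permE /= => -[].
by have := fx1 (inr a); rewrite !permE /= => -[].
Qed.

Lemma perm_rep_seq G Hs : {in Hs, forall H, H \subset G} ->
  perm_rep G (G :&: \bigcap_(H <- Hs) gcore H G) (\sum_(H <- Hs) #|G : H|).
Proof.
elim: Hs => [|H Hs IH] sHs.
  by rewrite !big_nil setIT; apply: perm_rep_trivial.
rewrite !big_cons setICA; apply: perm_rep_sum.
  by apply: perm_rep_cosets; apply: sHs; rewrite mem_head.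
by apply: IH => K HsK; apply: sHs; rewrite inE HsK orbT.
Qed.

Lemma embeds_perm_rep G n : embeds_in_Sym G n <-> perm_rep G 1 n.
Proof.
split=> [/existsP[K /isogP[f injf _]] | [T [f [<- kerf]]]].
  by exists 'I_n, f; rewrite card_ord; split=> //; apply/trivgP.
have injf : 'injm f by rewrite kerf.
pose p x (i : 'I_#|T|) := enum_rank (f x (enum_val i)).
have p_inj x : injective (p x).
  by move=> i j /enum_rank_inj/perm_inj/enum_val_inj.
have pM : {in G &, {morph (fun x => perm (@p_inj x)) : x y / x * y}}.
  move=> x y Gx Gy; apply/permP=> i.
  by rewrite permM !permE /p enum_rankK morphM // permM.
have injp : 'injm (Morphism pM).
  apply/injmP=> x y Gx Gy /permP pxy; apply: (injmP injf) => //.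
  apply/permP=> a; have := pxy (enum_rank a).
  by rewrite !permE /p enum_rankK => /enum_rank_inj.
by apply/existsP; exists (Morphism pM @* G)%G; apply: (sub_isog (subxx G) injp).
Qed.

Lemma mu_min G n : (0 < n)%N -> embeds_in_Sym G n -> (mu G <= n)%N.
Proof.
by move=> n0 en; rewrite /mu; case: ex_minnP => m _; apply; apply/andP.
Qed.

Lemma mu_gt0 G : (0 < mu G)%N.
Proof. by rewrite /mu; case: ex_minnP => m /andP[]. Qed.

Lemma mu_embeds G : embeds_in_Sym G (mu G).
Proof. by rewrite /mu; case: ex_minnP => m /andP[]. Qed.

Lemma mu_perm_rep G : perm_rep G 1 (mu G).
Proof. exact/embeds_perm_rep/mu_embeds. Qed.

(** The trivial group has a faithful representation of degree 0 while its [mu] is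
    1; a nontrivial group cannot act faithfully on no points. *)
Lemma mu_le_perm_rep G n : G :!=: 1 -> perm_rep G 1 n -> (mu G <= n)%N.
Proof.
move=> ntG repG; apply: mu_min; last exact/embeds_perm_rep.
case: repG => T [f [<- kerf]]; rewrite lt0n; apply: contra ntG => /eqP T0.
rewrite -subG1 -kerf; apply/subsetP=> x Gx; apply/kerP=> //; apply/permP=> a.
by have := card0_eq T0 a; rewrite !inE.
Qed.

Lemma mu_sub G H : H \subset G -> (mu H <= mu G)%N.
Proof.
move=> sHG; apply: mu_min (mu_gt0 G) _.
have /existsP[K /isogP[f injf _]] := mu_embeds G.
by apply/existsP; exists (f @* H)%G; apply: sub_isog.
Qed.

End PermRep.

Lemma mu_isog (gT hT : finGroupType) (G : {group gT}) (H : {group hT}) :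
  G \isog H -> mu G = mu H.
Proof.
move=> isoGH; apply: eq_ex_minn => n; congr (_ && _).
by apply: eq_existsb => K; apply: (isog_transl _ isoGH).
Qed.

Lemma perm_rep_pullback (aT gT : finGroupType) (D K : {group aT})
    (phi : {morphism D >-> gT}) (G : {group gT}) (N : {set gT}) n :
    K \subset phi @*^-1 G -> perm_rep G N n ->
  perm_rep K (K :&: phi @*^-1 N) n.
Proof.
move=> sK [T [f [<- <-]]]; exists T, (restrm_morphism sK (f \o phi)).
by rewrite ker_restrm ker_comp.
Qed.

Lemma mu_setX_le (gT hT : finGroupType) (G : {group gT}) (H : {group hT}) :
  (mu (setX_group G H) <= mu G + mu H)%N.
Proof.
apply: mu_min; first by rewrite addn_gt0 mu_gt0.
apply/embeds_perm_rep; pose GH := setX_group G H.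
have sfst : GH \subset fst_morphism gT hT @*^-1 G.
  by apply/subsetP=> -[x y] /setXP[Gx _]; rewrite !inE.
have ssnd : GH \subset snd_morphism gT hT @*^-1 H.
  by apply/subsetP=> -[x y] /setXP[_ Hy]; rewrite !inE.
have := perm_rep_sum (perm_rep_pullback sfst (mu_perm_rep G))
                     (perm_rep_pullback ssnd (mu_perm_rep H)).
congr (perm_rep _ _ _); apply/trivgP/subsetP=> -[x y].
by rewrite !inE /= => /andP[/andP[_ /eqP->] /andP[_ /eqP->]].
Qed.

(** * Families of subgroups *)

Section Families.

Variable gT : finGroupType.
Implicit Types (G H K A B Z X Y N : {group gT}) (Hs : seq {group gT}).

Definition capg Hs : {set gT} := \bigcap_(H <- Hs) H.

Lemma capg_group_set Hs : group_set (capg Hs).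
Proof.
by rewrite /capg; elim/big_ind: _ => [|C D gC gD|H _]; rewrite ?groupP //;
   apply: (groupP (Group gC :&: Group gD)).
Qed.

Canonical capg_group Hs := Group (capg_group_set Hs).

Lemma capg_cons H Hs : capg (H :: Hs) = H :&: capg Hs.
Proof. exact: big_cons. Qed.

Lemma capg_cat Hs1 Hs2 : capg (Hs1 ++ Hs2) = capg Hs1 :&: capg Hs2.
Proof. exact: big_cat. Qed.

(** The family consists of the stabilisers of one point in each orbit. A central
    element fixing a point fixes the whole orbit of that point, so testing it on
    the chosen points decides whether it acts trivially. *)
Lemma action_stabilisers G (T : finType) (D : {group gT}) (to : action D T) :
    G \subset D ->
  exists Hs, [/\ {in Hs, forall H, H \subset G},
    (\sum_(H <- Hs) #|G : H|)%N = #|T|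
    & 'Z(G) :&: capg Hs \subset 'C(setT | to)].
Proof.
move=> sGD.
have actG : [acts G, on [set: T] | to].
  apply/subsetP=> x Gx; rewrite !inE (subsetP sGD) //=.
  by apply/subsetP=> a; rewrite !inE.
have [_ _ orbX toX] := orbit_transversalP actG.
move: (orbit_transversal to G setT) orbX toX => X orbX toX.
exists [seq 'C_G[x | to]%G | x <- enum X]; split.
- by move=> _ /mapP[x _ ->]; apply: subsetIl.
- have orb_inj : {in X &, injective (orbit to G)}.
    by move=> x y Xx Xy eq_xy; apply/eqP; rewrite -orbX // eq_xy orbit_refl.
  have defP : [set orbit to G x | x in [set: T]] = orbit to G @: X.
    apply/setP=> O; apply/imsetP/imsetP=> -[x _ ->]; last by exists x.
    have [a Ga Xxa] := toX x (in_setT x); exists (to x a); first exact: Xxa.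
    exact/esym/orbit_act_in.
  rewrite big_map big_enum -cardsT (card_partition (orbit_partition actG)).
  rewrite defP big_imset //=; apply: eq_bigr => x _.
  by rewrite card_orbit_in.
apply/subsetP=> z /setIP[/centerP[Gz cz]].
rewrite /capg big_map big_enum /= => /bigcapP fixz.
rewrite !inE (subsetP sGD) //; apply/subsetP=> x _; rewrite inE; apply/eqP.
have [a Ga Xxa] := toX x (in_setT x).
have Dz := subsetP sGD z Gz; have Da := subsetP sGD a Ga.
have /setIP[_ /astab_act/(_ (set11 _)) fixxa] := fixz _ Xxa.
(* z fixes x because it commutes with a, and x is moved by a to a fixed point *)
apply: (@act_inj _ _ _ to a).
by rewrite -actMin // cz // actMin.
Qed.

Lemma mu_orbits G : exists Hs,
  [/\ {in Hs, forall H, H \subset G}, (\sum_(H <- Hs) #|G : H|)%N = mu G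
    & 'Z(G) :&: capg Hs = 1].
Proof.
have [T [f [<- kerf]]] := mu_perm_rep G.
have sG : G \subset f @*^-1 [set: {perm T}].
  by apply/subsetP=> x Gx; rewrite !inE Gx.
have [Hs [sHs <- fixHs]] := action_stabilisers (('P \o f)%act) sG.
exists Hs; split=> //; apply/trivgP; rewrite -kerf.
apply/subsetP=> x xZ; have Gx : x \in G by case/setIP: xZ => /setIP[].
apply/kerP=> //; apply/permP=> a; rewrite perm1.
exact: (astab_act (subsetP fixHs x xZ) (in_setT a)).
Qed.

Lemma index_leqS G A H : A \subset G -> (#|A : H| <= #|G : H|)%N.
Proof. by move=> sAG; apply/subset_leq_card/imsetS. Qed.

(** Equivalent to centrality of the socle ([center_detectsP]). This form applies
    directly to the kernel of a representation. *)
Definition center_detects G :=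
  forall N : {group gT}, N <| G -> N :&: 'Z(G) = 1 -> N :=: 1.

Lemma center_detectsP G :
  center_detects G <-> Soc G \subset 'Z(G).
Proof.
split=> [detG | sSZ N nsNG tiNZ].
  rewrite gen_subG; apply/bigcupsP=> N /andP[sNG].
  move=> /mingroupP[/andP[ntN nNG] minN].
  apply/setIidPl; apply: (minN (N :&: 'Z(G))%G); last exact: subsetIl.
  rewrite normsI ?gFnorm // andbT; apply: contra ntN => /eqP tiNZ.
  by apply/eqP/detG; rewrite // /normal sNG.
have /andP[sNG nNG] := nsNG.
have [// | /minnormal_exists/(_ nNG)[M minM sMN]] := eqVneq (N : {set gT}) 1.
have /mingroupP[/andP[ntM _] _] := minM.
case/negP: ntM; rewrite -subG1 -tiNZ subsetI sMN (subset_trans _ sSZ) //.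
by rewrite sub_gen // (bigcup_max M) // (subset_trans sMN sNG).
Qed.

(** The kernel of the action on the cosets of all members is normal and lies in
    each of them, so it meets the center trivially. The members are arbitrary
    subgroups of the ambient type, so that part of a family for a direct product
    can be used for one of the factors. *)
Lemma mu_le_sum_index G Hs :
    G :!=: 1 -> center_detects G -> 'Z(G) :&: capg Hs = 1 ->
  (mu G <= \sum_(H <- Hs) #|G : H|)%N.
Proof.
move=> ntG detG trHs; pose Ks := [seq (G :&: H)%G | H <- Hs].
have -> : (\sum_(H <- Hs) #|G : H|)%N = (\sum_(H <- Ks) #|G : H|)%N.
  by rewrite big_map; apply: eq_bigr => H _; rewrite /= indexgI.
apply: mu_le_perm_rep => //.
have [|T [f [cT kerf]]] := @perm_rep_seq _ G Ks.
  by move=> _ /mapP[H _ ->]; apply: subsetIl.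
exists T, f; split=> //.
apply: detG; first exact: ker_normal.
apply/trivgP; rewrite -trHs /= kerf setIC setIS // subIset //; apply/orP; right.
rewrite /Ks big_map /capg; elim: (Hs) => [|H L IH]; first by rewrite !big_nil.
by rewrite !big_cons setISS //= (subset_trans (gcore_sub _ _)) ?subsetIr.
Qed.

(** * Refining a family to meet-irreducible traces on the center *)

(** Meet-irreducibility of the trace [Z :&: H] in the lattice of subgroups of Z,
    as a boolean so that the refinement below can branch on it. *)
Definition meet_irreducible Z H : bool :=
  [forall K1 : {group gT}, [forall K2 : {group gT},
    [&& Z :&: H \subset K1, K1 \subset Z, Z :&: H \subset K2, K2 \subset Z
      & K1 :&: K2 \subset H] ==> (K1 \subset H) || (K2 \subset H)]].

(** Induction on the index: a reducible trace is the meet of K1 and K2, and H is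
    replaced by what the induction gives for H K1 and for H K2. *)
Lemma refine_subgroup G Z H : Z \subset 'Z(G) -> H \subset G ->
  exists Hs, [/\ {in Hs, forall K, meet_irreducible Z K},
    (\sum_(K <- Hs) #|G : K| <= #|G : H|)%N & Z :&: capg Hs \subset H].
Proof.
move=> sZ; have [n] := ubnP #|G : H|; elim: n H => // n IH H leHn sHG.
have [irrH | ] := boolP (meet_irreducible Z H).
  exists [:: H]; rewrite big_seq1 capg_cons; split=> //.
    by move=> K; rewrite inE => /eqP->.
  by rewrite setICA subsetIl.
rewrite negb_forall => /existsP[K1]; rewrite negb_forall => /existsP[K2].
rewrite negb_imply negb_or.
case/andP=> /and5P[sHK1 sK1Z sHK2 sK2Z sK12] /andP[nK1 nK2].
(* H K has index at most half that of H, and its own trace on Z is K *)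
have step K : Z :&: H \subset K -> K \subset Z -> ~~ (K \subset H) ->
    exists Hs, [/\ {in Hs, forall L, meet_irreducible Z L},
      (2 * \sum_(L <- Hs) #|G : L| <= #|G : H|)%N & Z :&: capg Hs \subset K].
- move=> sHK sKZ nKH.
  have /subsetIP[sKG cGK] := subset_trans sKZ sZ.
  have cHK : K \subset 'C(H) := subset_trans cGK (centS sHG).
  have sHKG : H <*> K \subset G by rewrite join_subG sHG.
  have lt2 : (1 < #|H <*> K : H|)%N by rewrite indexg_gt1 join_subG subxx.
  have eqi : (#|G : H <*> K| * #|H <*> K : H|)%N = #|G : H|.
    by rewrite Lagrange_index ?joing_subl.
  have [|//|Hs [irrHs leHs sHs]] := IH (H <*> K)%G.
    rewrite -ltnS (leq_trans _ leHn) // ltnS -eqi.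
    by rewrite -[X in (X < _)%N]muln1 ltn_pmul2l.
  exists Hs; split=> //.
    by rewrite -eqi mulnC leq_mul.
  apply: (@subset_trans _ _ (Z :&: H <*> K)); first by rewrite subsetI subsetIl.
  by rewrite cent_joinEr // -group_modr // mul_subG.
have [Hs1 [irr1 le1 s1]] := step K1 sHK1 sK1Z nK1.
have [Hs2 [irr2 le2 s2]] := step K2 sHK2 sK2Z nK2.
exists (Hs1 ++ Hs2); split.
- by move=> L; rewrite mem_cat => /orP[/irr1|/irr2].
- rewrite big_cat -(leq_pmul2l (isT : (0 < 2)%N)) mulnDr [leqRHS]mul2n -addnn.
  exact: leq_add.
by rewrite capg_cat setIIr (subset_trans (setISS s1 s2)).
Qed.

Lemma refine_family G Z Hs :
    Z \subset 'Z(G) -> {in Hs, forall H, H \subset G} ->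
  exists Ks, [/\ {in Ks, forall K, meet_irreducible Z K},
    (\sum_(K <- Ks) #|G : K| <= \sum_(H <- Hs) #|G : H|)%N
    & Z :&: capg Ks \subset capg Hs].
Proof.
move=> sZ; elim: Hs => [|H Hs IH] sHs.
  by exists [::]; rewrite !big_nil /capg !big_nil subsetT.
have [|Ks [irrK leK sK]] := IH.
  by move=> K HsK; rewrite sHs ?inE ?HsK ?orbT.
have [|Ls [irrL leL sL]] := refine_subgroup sZ (_ : H \subset G).
  by rewrite sHs ?mem_head.
exists (Ls ++ Ks); split.
- by move=> L; rewrite mem_cat => /orP[/irrL|/irrK].
- by rewrite big_cat big_cons leq_add.
by rewrite capg_cat capg_cons setIIr setISS.
Qed.

(** * Splitting a family between two direct factors *)

(** By induction on the family. Let M be the first member and D the part of X Y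
    cut out by the others, so that D meets M trivially. Handing M to X replaces
    X by X1 = X :&: M and leaves D1, the part of X1 Y cut out by the others;
    handing it to Y similarly leaves D2. Since X1 Y meets X Y1 in X1 Y1, which
    is contained in M, the groups D1 and D2 are independent subgroups of D, and
    they stay independent modulo M. As the trace of M is meet-irreducible, one
    of them lies in M, hence is trivial, and M can be given to that side. *)
Lemma split_family Z X Y Hs :
    abelian Z -> X \subset Z -> Y \subset Z -> X :&: Y = 1 ->
    {in Hs, forall H, meet_irreducible Z H} -> (X <*> Y) :&: capg Hs = 1 ->
  exists Hs1 Hs2, [/\ perm_eq Hs (Hs1 ++ Hs2), X :&: capg Hs1 = 1
    & Y :&: capg Hs2 = 1].
Proof.
move=> abZ; elim: Hs X Y => [|M Hs IH] X Y sXZ sYZ tiXY irrHs trHs.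
  exists [::], [::]; rewrite /capg big_nil !setIT in trHs *; split=> //.
    by apply/trivgP; rewrite -trHs joing_subl.
  by apply/trivgP; rewrite -trHs joing_subr.
have prodE (U V : {group gT}) : U \subset Z -> V \subset Z -> U <*> V = U * V.
  by move=> sU sV; apply: cent_joinEr; apply: centSS sV sU abZ.
have irrK : {in Hs, forall H, meet_irreducible Z H}.
  by move=> H HsH; rewrite irrHs // inE HsH orbT.
have irrM : meet_irreducible Z M by rewrite irrHs ?mem_head.
pose X1 := (X :&: M)%G; pose Y1 := (Y :&: M)%G.
have sX1 : X1 \subset X := subsetIl _ _.
have sY1 : Y1 \subset Y := subsetIl _ _.
have sX1Z := subset_trans sX1 sXZ; have sY1Z := subset_trans sY1 sYZ.
pose D := (X <*> Y :&: capg Hs)%G.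
have tiDM : D :&: M = 1 by rewrite -setIA (setIC _ M) -capg_cons.
have sDZ : D \subset Z.
  by rewrite (subset_trans (subsetIl _ _)) // join_subG sXZ.
pose D1 := (X1 <*> Y :&: capg Hs)%G; pose D2 := (X <*> Y1 :&: capg Hs)%G.
have sD1 : D1 \subset D by rewrite setSI // genS // setSU.
have sD2 : D2 \subset D by rewrite setSI // genS // setUS.
have sD1Z := subset_trans sD1 sDZ; have sD2Z := subset_trans sD2 sDZ.
(* X1 Y meets X Y1 in X1 Y1, by uniqueness of components *)
have sD12 : D1 :&: D2 \subset M.
  apply/subsetP=> z /setIP[/setIP[+ _] /setIP[+ _]].
  rewrite /= !prodE // => /mulsgP[x1 y X1x1 Yy ->] /mulsgP[x y1 Xx Y1y1 eq_xy].
  have Xx1 := subsetP sX1 _ X1x1; have Yy1 := subsetP sY1 _ Y1y1.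
  have xx1 : x^-1 * x1 = y1 * y^-1.
    by apply: (mulgI x); apply: (mulIg y); rewrite mulKVg eq_xy !mulgA mulgKV.
  have /set1P : x^-1 * x1 \in [1].
    by rewrite -tiXY inE groupM ?groupV //= xx1 groupM ?groupV.
  move=> e; rewrite e in xx1; have {}e : y = y1.
    by apply/eqP; rewrite eq_mulgV1 -[y * _]invgK invMg invgK -xx1 invg1.
  by rewrite e groupM //; [case/setIP: X1x1 | case/setIP: Y1y1].
have sMZ : Z :&: M \subset Z := subsetIl _ _.
(* adding the trace of M preserves independence of D1 and D2 modulo M *)
pose K1 := (D1 <*> (Z :&: M))%G; pose K2 := (D2 <*> (Z :&: M))%G.
have sK12 : K1 :&: K2 \subset M.
  apply/subsetP=> z /setIP[]; rewrite /= !prodE //.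
  case/mulsgP=> d1 m1 D1d1 /setIP[_ Mm1] ->.
  case/mulsgP=> d2 m2 D2d2 /setIP[_ Mm2] eq_dm.
  have e : d2^-1 * d1 = m2 * m1^-1.
    by apply: (mulgI d2); apply: (mulIg m1); rewrite mulKVg eq_dm !mulgA mulgKV.
  have /set1P e1 : d2^-1 * d1 \in [1].
    rewrite -tiDM inE {2}e !groupM ?groupV //; first exact: (subsetP sD2).
    exact: (subsetP sD1).
  rewrite groupM // (subsetP sD12) // inE D1d1 /=.
  by rewrite -[d1](mulKVg d2) e1 mulg1.
have : (K1 \subset M) || (K2 \subset M).
  move/forallP: irrM => /(_ K1)/forallP/(_ K2)/implyP; apply.
  by rewrite sK12 !joing_subr !join_subG sMZ sD1Z sD2Z.
case/orP=> sKM.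
  have trD1 : X1 <*> Y :&: capg Hs = 1.
    apply/trivgP; rewrite -tiDM subsetI sD1.
    by apply: subset_trans sKM; apply: joing_subl.
  have [|Hs1 [Hs2 [eqHs tr1 tr2]]] := IH X1 Y sX1Z sYZ _ irrK trD1.
    by apply/trivgP; rewrite -tiXY setSI.
  by exists (M :: Hs1), Hs2; rewrite /= perm_cons capg_cons setIA.
have trD2 : X <*> Y1 :&: capg Hs = 1.
  apply/trivgP; rewrite -tiDM subsetI sD2.
  by apply: subset_trans sKM; apply: joing_subl.
have [|Hs1 [Hs2 [eqHs tr1 tr2]]] := IH X Y1 sXZ sY1Z _ irrK trD2.
  by apply/trivgP; rewrite -tiXY setIS.
exists Hs1, (M :: Hs2); rewrite capg_cons setIA; split=> //.
rewrite (perm_trans (_ : perm_eq _ (M :: Hs1 ++ Hs2))) ?perm_cons //.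
by rewrite perm_sym (perm_catCA Hs1 [:: M] Hs2).
Qed.

(** A family realising mu G is refined, split along Z(G) = Z(A) \x Z(B), and each
    part is then used for its own factor. *)
Lemma mu_dprod_ge A B G :
    A \x B = G -> A :!=: 1 -> B :!=: 1 ->
    center_detects A -> center_detects B ->
  (mu A + mu B <= mu G)%N.
Proof.
move=> defG ntA ntB detA detB.
have [Hs [sHs <- trHs]] := mu_orbits G.
have [Ks [irrK leK sK]] := refine_family (subxx 'Z(G)) sHs.
have [_ defZ cZ tiZ] := dprodP (center_dprod defG).
have [_ defAB _ _] := dprodP defG.
have sAG : A \subset G by rewrite -defAB mulG_subl.
have sBG : B \subset G by rewrite -defAB mulG_subr.
have sZA : 'Z(A) \subset 'Z(G) by rewrite -defZ mulG_subl.
have sZB : 'Z(B) \subset 'Z(G) by rewrite -defZ mulG_subr.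
have trK : 'Z(A) <*> 'Z(B) :&: capg Ks = 1.
  apply/trivgP; rewrite /= cent_joinEr // defZ -trHs subsetI subsetIl.
  exact: sK.
have [K1 [K2 [eqK tr1 tr2]]] :=
  split_family (center_abelian G) sZA sZB tiZ irrK trK.
apply: leq_trans leK; rewrite (perm_big _ eqK) big_cat /=.
apply: leq_add.
  apply: leq_trans (mu_le_sum_index ntA detA tr1) _.
  by apply: leq_sum => K _; apply: index_leqS.
apply: leq_trans (mu_le_sum_index ntB detB tr2) _.
by apply: leq_sum => K _; apply: index_leqS.
Qed.

(** * Central socles in direct products *)

(** A normal subgroup N avoiding the center of G avoids A and B, hence commutes
    with both; so it is central, and therefore trivial. *)
Lemma center_detects_dprod A B G :
  A \x B = G -> center_detects A -> center_detects B -> center_detects G.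
Proof.
move=> defG detA detB N /andP[sNG nNG] tiNZ.
have [_ defAB cAB tiAB] := dprodP defG.
have [_ defZ _ _] := dprodP (center_dprod defG).
have [nsAG nsBG] := dprod_normal2 defG.
have trI (C : {group gT}) :
    C <| G -> center_detects C -> 'Z(C) \subset 'Z(G) -> N :&: C = 1.
  case/andP=> sCG nCG detC sZC.
  apply: (detC (N :&: C)%G).
    by rewrite /normal subsetIr normsI ?normG // (subset_trans sCG).
  apply/trivgP; rewrite -tiNZ /= -setIA setIS //.
  by rewrite subIset // sZC orbT.
have cC (C : {group gT}) :
    C <| G -> center_detects C -> 'Z(C) \subset 'Z(G) -> C \subset 'C(N).
  move=> nsCG detC sZC; have /andP[sCG nCG] := nsCG.
  rewrite (sameP commG1P trivgP) -(trI C) // setIC commg_subI // subsetI subxx.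
    exact: subset_trans sCG nNG.
  exact: subset_trans sNG nCG.
have cGN : G \subset 'C(N).
  by rewrite -defAB mul_subG ?cC // -defZ ?mulG_subl ?mulG_subr.
by rewrite -tiNZ; apply/esym/setIidPl; rewrite subsetI sNG centsC.
Qed.

End Families.

Lemma center_detects_injm (aT rT : finGroupType) (G : {group aT})
    (f : {morphism G >-> rT}) :
  'injm f -> center_detects G -> center_detects (f @* G)%G.
Proof.
move=> injf detG N nsN tiN.
rewrite -(morphpreK (normal_sub nsN)).
have -> : f @*^-1 N = 1; last exact: morphim1.
apply: (detG (f @*^-1 N)%G).
  have defG : f @*^-1 (f @* G) = G by rewrite morphimGK // (trivgP injf) sub1G.
  by rewrite -[X in _ <| X]defG morphpre_normal // normal_sub.
have sG : f @*^-1 N :&: 'Z(G) \subset G by rewrite subIset // subsetIl.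
apply/eqP; rewrite -(morphim_injm_eq1 injf sG) injmI // injm_center //.
by rewrite morphpreK ?normal_sub //= tiN.
Qed.

Lemma center_detects_isog (gT hT : finGroupType)
    (G : {group gT}) (H : {group hT}) :
  G \isog H -> center_detects G -> center_detects H.
Proof.
case/isogP=> f injf defH detG N; rewrite -defH.
exact: (center_detects_injm injf detG).
Qed.

Theorem lemma13 (gT hT : finGroupType) (G : {group gT}) (H : {group hT})
    (hG : CSE G) (hH : CSE H) :
  CSE (setX_group G H) /\ mu (setX_group G H) = (mu G + mu H)%N.
Proof.
case: hG => G0 [sG0 [ntG0 /center_detectsP detG0] muG].
case: hH => H0 [sH0 [ntH0 /center_detectsP detH0] muH].
have isoG := isog_setX1 hT G0; have isoH := isog_set1X gT H0.
have defGH : @setX_group gT hT G0 1 \x setX_group 1 H0 = setX_group G0 H0.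
  exact: setX_dprod.
have detG1 := center_detects_isog isoG detG0.
have detH1 := center_detects_isog isoH detH0.
have ntG1 : @setX_group gT hT G0 1 :!=: 1.
  by move: ntG0; rewrite (isog_eq1 isoG).
have ntH1 : @setX_group gT hT 1 H0 :!=: 1.
  by move: ntH0; rewrite (isog_eq1 isoH).
have sGH : setX_group G0 H0 \subset setX_group G H by apply: setXS.
have ge_mu : (mu G + mu H <= mu (setX_group G0 H0))%N.
  rewrite -muG -muH (mu_isog isoG) (mu_isog isoH).
  exact: mu_dprod_ge defGH ntG1 ntH1 detG1 detH1.
have le_mu := mu_sub sGH.
have mu_eq : mu (setX_group G H) = (mu G + mu H)%N.
  by apply/eqP; rewrite eqn_leq mu_setX_le (leq_trans ge_mu).
split=> //; exists (setX_group G0 H0); split=> //.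
  split; last first.
    apply/center_detectsP; exact: center_detects_dprod defGH detG1 detH1.
  apply: contra ntG1; rewrite -!subG1; apply: subset_trans.
  by rewrite setXS // sub1G.
by apply/eqP; rewrite eqn_leq le_mu mu_eq.
Qed.
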